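(* Let $n\ge 1$ and $\pi,\sigma\in\mathfrak{B}_n$, and let $(\ell_1,\ell_2,\ell_3,\ell_4)$ be the length vector of $\sigma$. Then: (1) $\pi\le\sigma$ if and only if $f_{2143}(\pi)\ge f_{2143}(\sigma)$; (2) $\beta(\sigma)=\frac12\ell_2\ell_3(\ell_2+\ell_3)$; (3) $\alpha(\sigma)=\frac12\ell_1\ell_4(\ell_1+\ell_4)$; (4) $\beta(\sigma)=\alpha(f_{2143}(\sigma))$.
   Context: $\mathfrak{S}_n$ is the set of permutations of $[n]=\{1,\dots,n\}$, in one-line notation. A reduction of $\omega\in\mathfrak{S}_n$ interchanges $\omega(i)$ and $\omega(j)$ for some $i<j$ with $\omega(i)>\omega(j)$. Bruhat order: $\pi\le\sigma$ if $\pi$ is obtained from $\sigma$ by a (possibly empty) sequence of reductions. $\mathfrak{B}_n\subseteq\mathfrak{S}_n$ is the set of bigrassmannian permutations (both $\omega$ and $\omega^{-1}$ have exactly one descent); equivalently $\omega=1\cdots a\,(b+1)\cdots c\,(a+1)\cdots b\,(c+1)\cdots n$ for a unique triple $0\le a<b<c\le n$. The length vector of such an element is $(\ell_1,\ell_2,\ell_3,\ell_4)=(a+1,b-a,c-b,n+1-c)$; this gives a bijection between $\mathfrak{B}_n$ and vectors of four positive integers with sum $n+2$. For $\sigma\in\mathfrak{B}_n$ with length vector $(\ell_1,\ell_2,\ell_3,\ell_4)$, $f_{2143}(\sigma)$ is the element of $\mathfrak{B}_n$ with length vector $(\ell_2,\ell_1,\ell_4,\ell_3)$. $\beta(\sigma)$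 is the number of $\pi\in\mathfrak{B}_n$ with $\pi\le\sigma$, and $\alpha(\sigma)$ is the number of $\tau\in\mathfrak{B}_n$ with $\sigma\le\tau$. *)

(* Defs.v *)
From mathcomp Require Import all_boot all_order all_fingroup all_algebra.
From mathcomp Require Import zify.

Set Implicit Arguments.
Unset Strict Implicit.
Unset Printing Implicit Defensive.

(* Permutations of [n] are elements of 'S_n, acting on the 0-based 'I_n;
   [one_line] shifts back to the 1-based one-line notation. *)
Definition one_line n (s : 'S_n) : seq nat := [seq (s i).+1 | i <- enum 'I_n].

(* In 'S_n products act from left to right: (tperm i j * s) k = s (tperm i j k),
   so this interchanges the entries of s in positions i and j. *)
Definition reduction n : rel 'S_n := fun s p =>
  [exists i : 'I_n, exists j : 'I_n,
     [&& i < j, s j < s i & p == (tperm i j * s)%g]].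

Definition bruhat n : rel 'S_n := fun p s => connect (@reduction n) s p.

Definition descents n (s : 'S_n) : {set 'I_n} :=
  [set i : 'I_n | [exists j : 'I_n, (j == i.+1 :> nat) && (s j < s i)]].

Definition bigrassmannian n : pred 'S_n := fun s =>
  (#|descents s| == 1) && (#|descents s^-1%g| == 1).

Definition bigrass n := {s : 'S_n | bigrassmannian s}.

(* 1 .. a (b+1) .. c (a+1) .. b (c+1) .. n *)
Definition block_word (n a b c : nat) : seq nat :=
  iota 1 a ++ iota b.+1 (c - b) ++ iota a.+1 (b - a) ++ iota c.+1 (n - c).

Definition is_block n (s : 'S_n) (a b c : nat) : bool :=
  [&& a < b, b < c, c <= n & one_line s == block_word n a b c].

(* The default is never reached on bigrassmannian permutations, see
   [length_vectorP]. *)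
Definition length_vector n (s : 'S_n) : nat * nat * nat * nat :=
  if [pick t : 'I_n.+1 * 'I_n.+1 * 'I_n.+1 | is_block s t.1.1 t.1.2 t.2]
    is Some (a, b, c)
  then (a.+1, b - a, c - b, n.+1 - c)
  else (0, 0, 0, 0).

(* The default is never reached, see [length_vector_f2143]. *)
Definition f2143 n (s : bigrass n) : bigrass n :=
  let: (l1, l2, l3, l4) := length_vector (val s) in
  odflt s [pick t : bigrass n | length_vector (val t) == (l2, l1, l4, l3)].

Definition beta n (s : bigrass n) : nat :=
  #|[set p : bigrass n | bruhat (val p) (val s)]|.

Definition alpha n (s : bigrass n) : nat :=
  #|[set t : bigrass n | bruhat (val s) (val t)]|.

(* The lemmas below check that triples and length vectors are well defined:
   [is_blockP] and [is_block_uniq] are the characterization of bigrassmannian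
   permutations by a unique triple, and
   [length_vector_inj], [length_vectorP] and [length_vector_surj] say that
   [length_vector] is a bijection from [bigrass n] to the vectors of four
   positive integers with sum n + 2. *)

Definition block_val (a b c i : nat) : nat :=
  if i < a then i else
  if i < a + (c - b) then i + (b - a) else
  if i < c then i - (c - b) else i.

Lemma nth_block_word n a b c i : a < b -> b < c -> c <= n -> i < n ->
  nth 0 (block_word n a b c) i = (block_val a b c i).+1.
Proof.
move=> ab bc cn i_n; rewrite /block_word /block_val !nth_cat !size_iota.
by do 6?case: ifP => ?; rewrite ?nth_iota; lia.
Qed.

Lemma size_block_word n a b c : a < b -> b < c -> c <= n ->
  size (block_word n a b c) = n.
Proof. by rewrite /block_word !size_cat !size_iota; lia. Qed.

Lemma nth_one_line n (s : 'S_n) (i : 'I_n) : nth 0 (one_line s) i = (s i).+1.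
Proof.
by rewrite /one_line (nth_map i) ?size_enum_ord // nth_ord_enum.
Qed.

Lemma size_one_line n (s : 'S_n) : size (one_line s) = n.
Proof. by rewrite size_map size_enum_ord. Qed.

Lemma is_block_valP n (s : 'S_n) a b c :
  reflect ([/\ a < b, b < c, c <= n &
             forall i, s i = block_val a b c i :> nat])
          (is_block s a b c).
Proof.
apply: (iffP and4P) => [[ab bc cn /eqP e]|[ab bc cn e]]; split=> //.
  move=> i; have := nth_one_line s i.
  by rewrite e nth_block_word //; case.
apply/eqP/(@eq_from_nth _ 0); rewrite size_one_line ?size_block_word //.
move=> i i_n; rewrite nth_block_word //.
by rewrite (nth_one_line s (Ordinal i_n)) e.
Qed.

Lemma block_perm n a b c : a < b -> b < c -> c <= n ->
  exists s : 'S_n, is_block s a b c.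
Proof.
move=> ab bc cn.
have bn (i : 'I_n) : block_val a b c i < n.
  by have := ltn_ord i; rewrite /block_val; repeat case: ifP; lia.
have inj : injective (fun i => Ordinal (bn i)).
  move=> i j /(congr1 val) /= h; apply/val_inj; move: h.
  by rewrite /= /block_val; repeat case: ifP; lia.
exists (perm inj); apply/is_block_valP; split=> // i.
by rewrite permE.
Qed.

Lemma is_block_inv n (s : 'S_n) a b c :
  is_block s a b c -> is_block s^-1%g a (a + (c - b)) c.
Proof.
move=> /is_block_valP[ab bc cn e]; apply/is_block_valP; split; try lia.
move=> i; have := e (s^-1%g i); rewrite permKV => h.
have := ltn_ord (s^-1%g i); move: h; rewrite /block_val.
by repeat case: ifP; lia.
Qed.

Lemma is_block_descents n (s : 'S_n) a b c :
  is_block s a b c -> #|descents s| == 1.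
Proof.
move=> /is_block_valP[ab bc cn e].
have dn : a + (c - b) - 1 < n by lia.
apply/cards1P; exists (Ordinal dn); apply/setP => i; rewrite !inE.
apply/existsP/eqP => [[j /andP[/eqP ji]]|->].
  rewrite !e ji => h; apply/val_inj => /=; move: h; rewrite /block_val.
  by have := ltn_ord j; repeat case: ifP; lia.
have jn : a + (c - b) < n by lia.
exists (Ordinal jn); rewrite !e /=.
apply/andP; split; first by apply/eqP; lia.
by rewrite /block_val; repeat case: ifP; lia.
Qed.

Lemma is_block_bigrassmannian n (s : 'S_n) a b c :
  is_block s a b c -> bigrassmannian s.
Proof.
move=> h; rewrite /bigrassmannian (is_block_descents h).
by rewrite (is_block_descents (is_block_inv h)).
Qed.

(* f and g represent a permutation of {0, .., n-1} and its inverse, whose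
   unique descents are in positions d and e. *)
Lemma increasing_on (f : nat -> nat) lo hi :
  (forall i, lo <= i -> i.+1 < hi -> f i < f i.+1) ->
  forall i j, lo <= i -> i < j -> j < hi -> f i < f j.
Proof.
move=> h i j li; elim: j => // j IH ij jh.
have := h j; have [<-|ne] := eqVneq i j; first by lia.
by have := IH; lia.
Qed.

Definition one_descent (n : nat) (f : nat -> nat) (d : nat) :=
  [/\ d.+1 < n, f d.+1 < f d
    & forall i, i.+1 < n -> i <> d -> f i < f i.+1].

Definition inverse_on (n : nat) (f g : nat -> nat) :=
  forall i, i < n -> f i < n /\ g (f i) = i.

Lemma one_descent_lo n f d : one_descent n f d ->
  forall i j, i < j -> j <= d -> f i < f j.
Proof.
move=> [dn _ h] i j ij jd.
apply: (@increasing_on f 0 d.+1) => // k _ kd; apply: h; lia.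
Qed.

Lemma one_descent_hi n f d : one_descent n f d ->
  forall i j, d < i -> i < j -> j < n -> f i < f j.
Proof.
move=> [dn _ h] i j di ij jn.
apply: (@increasing_on f d.+1 n) => // k kd kn; apply: h; lia.
Qed.

Lemma one_descent_block n f g d e :
  inverse_on n f g -> inverse_on n g f -> one_descent n f d -> one_descent n g e ->
  let a := g e.+1 in
  [/\ a <= d, forall i, i < a -> f i = i &
      forall i, a <= i -> i <= d -> f i = i + (e.+1 - a)].
Proof.
move=> fg gf df dg a.
have [[dn dd _] [en ee _]] := (df, dg).
have flo := one_descent_lo df; have fhi := one_descent_hi df.
have glo := one_descent_lo dg; have ghi := one_descent_hi dg.
have [an fa] : a < n /\ f a = e.+1 by apply: gf.
have small i : i < n -> i < a -> f i <= e.
  move=> i_n ia; rewrite leqNgt; apply/negP => h.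
  have [fin gfi] := fg _ i_n.
  have [h'|h'] := eqVneq (f i) e.+1; first by move: gfi; rewrite h' -/a; lia.
  by have := ghi e.+1 (f i); rewrite gfi -/a; lia.
have ad : a <= d.
  rewrite leqNgt; apply/negP => da.
  have [_ g1] := fg d (ltn_trans (ltnSn d) dn).
  have [_ g2] := fg d.+1 dn.
  have := small d; have := glo (f d.+1) (f d); rewrite g1 g2; lia.
have ae : f a > e by rewrite fa.
have stepf i : i.+1 <= d -> (f i.+1 <= e) || (e < f i) -> f i.+1 = (f i).+1.
  move=> id side.
  have [fi_n gfi] := fg i ltac:(lia).
  have [fi1_n gfi1] := fg i.+1 ltac:(lia).
  have lt := flo i i.+1 (ltnSn i) id.
  have [//|ne] := eqVneq (f i.+1) (f i).+1.
  have : g (f i) < g (f i).+1 /\ g (f i).+1 < g (f i.+1).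
    by case/orP: side => side; split; (apply: glo; lia) || (apply: ghi; lia).
  rewrite gfi gfi1; lia.
have fix_f i : i < a -> f i = i.
  elim: i => [|i IH] ia.
    have [f0n gf0] := fg 0 ltac:(lia).
    have := small 0 ltac:(lia) ia.
    have [->//|ne] := eqVneq (f 0) 0.
    by have := glo 0 (f 0); rewrite gf0; lia.
  rewrite stepf; [by rewrite IH; lia|lia|].
  by rewrite small //; lia.
have ae1 : a <= e.+1.
  have [->//|a0] := eqVneq a 0.
  have := fix_f a.-1 ltac:(lia); have := flo a.-1 a ltac:(lia) ad; lia.
have big i : a <= i -> i <= d -> e < f i.
  move=> ai id; have [<-//|ne] := eqVneq a i.
  have := flo a i ltac:(lia) id; lia.
split=> //; elim=> [|i IH] ai id; first by rewrite (_ : 0 = a) ?fa; lia.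
have [->|ne] := eqVneq i.+1 a; first by rewrite fa; lia.
by rewrite stepf ?IH ?big ?orbT //; lia.
Qed.

Lemma one_descent_perm n (s : 'S_n) (f : nat -> nat) :
  (forall i : 'I_n, f i = s i) -> #|descents s| == 1 ->
  exists d, one_descent n f d.
Proof.
move=> fs /cards1P[d ds]; exists d.
have : d \in descents s by rewrite ds set11.
rewrite inE => /existsP[j /andP[/eqP jd lt]]; split.
- by rewrite -jd.
- by rewrite -jd !fs.
- move=> i i1n id; have i_n : i < n by lia.
  have notd : Ordinal i_n \notin descents s.
    by rewrite ds inE; apply/eqP => /(congr1 val).
  move: notd; rewrite inE negb_exists => /forallP/(_ (Ordinal i1n)) /=.
  rewrite eqxx /= -leqNgt leq_eqVlt -!fs /= => /orP[/eqP h|//].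
  have /perm_inj/(congr1 val) /= : s (Ordinal i_n) = s (Ordinal i1n).
    by apply/val_inj; rewrite /= -!fs.
  lia.
Qed.

Lemma bigrassmannian_block n (s : 'S_n) :
  bigrassmannian s -> exists a b c, is_block s a b c.
Proof.
move=> /andP[s1 s2].
pose fn (t : 'S_n) i := if insub i is Some j then val (t j) else 0.
have fnE t (i : 'I_n) : fn t i = t i.
  by rewrite /fn insubT // => i_n; congr (val (t _)); apply/val_inj.
have fnO t i (i_n : i < n) : fn t i = t (Ordinal i_n) by rewrite -fnE.
pose f := fn s; pose g := fn s^-1%g.
have fg : inverse_on n f g.
  by move=> i i_n; rewrite /f /g (fnO _ i i_n) fnE permK.
have gf : inverse_on n g f.
  by move=> i i_n; rewrite /f /g (fnO _ i i_n) fnE permKV.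
have [d df] := one_descent_perm (fnE s) s1.
have [e dg] := one_descent_perm (fnE s^-1%g) s2.
have [a_d f1 f2] := one_descent_block fg gf df dg.
have [a'_e g1 g2] := one_descent_block gf fg dg df.
have [[dn dd _] [en ee _]] := (df, dg).
rewrite -/f -/g in df dg a_d f1 f2 a'_e g1 g2 dd ee.
set a := g e.+1 in a_d f1 f2; set a' := f d.+1 in a'_e g1 g2.
have [an fa] : a < n /\ f a = e.+1 by apply: gf.
have [a'n ga'] : a' < n /\ g a' = d.+1 by apply: fg.
have aa' : a' = a.
  have [lt|lt|//] := ltngtP a' a.
    by have [_] := fg a' a'n; rewrite (f1 _ lt) ga'; lia.
  by have [_] := gf a an; rewrite g1 // fa; lia.
rewrite aa' in a'n a'_e g1 g2 ga'.
set c := d.+1 + (e.+1 - a).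
have mid i : a <= i -> i <= e -> f (i + (d.+1 - a)) = i.
  by move=> ai ie; rewrite -(g2 i ai ie); apply: (gf i _).2; lia.
have fhi := one_descent_hi df; have ghi := one_descent_hi dg.
have cn : c <= n.
  have [h _] := gf e ltac:(lia); move: h; rewrite g2 // /c; lia.
have fc i : c <= i -> i < n -> i <= f i.
  elim: i => [|i IH] ci i1n; first by lia.
  have [cE|ne] := eqVneq c i.+1; last first.
    by have := IH; have := fhi i i.+1; lia.
  rewrite leqNgt; apply/negP => lt.
  have [_ gfi] := fg i.+1 i1n.
  have [h|h] := ltnP (f i.+1) a.
    by have [_] := fg (f i.+1) ltac:(lia); rewrite (f1 _ h) gfi; lia.
  have [h'|h'] := leqP (f i.+1) e.
    by move: gfi; rewrite g2 //; lia.
  have := f2 (f i.+1 - (e.+1 - a)) ltac:(lia) ltac:(lia).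
  rewrite subnK; last by lia.
  move=> /(congr1 g); rewrite gfi (fg _ _).2; lia.
have cf k : k < n -> c <= n.-1 - k -> f (n.-1 - k) <= n.-1 - k.
  elim: k => [|k IH] kn ck.
    by have [] := fg (n.-1 - 0) ltac:(lia); lia.
  have := IH ltac:(lia) ltac:(lia).
  by have := fhi (n.-1 - k.+1) (n.-1 - k) ltac:(lia) ltac:(lia) ltac:(lia); lia.
exists a, e.+1, c; apply/is_block_valP; split; try lia.
move=> i; rewrite -fnE -/f; have i_n := ltn_ord i; rewrite /block_val.
case: ifP => h1; first by rewrite f1.
case: ifP => h2; first by rewrite f2; lia.
case: ifP => h3.
  have := mid (i - (d.+1 - a)) ltac:(lia) ltac:(lia).
  rewrite subnK; lia.
have := cf (n.-1 - i) ltac:(lia); rewrite subKn; last by lia.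
have := fc i; lia.
Qed.

Lemma is_block_uniq n (s : 'S_n) a b c a' b' c' :
  is_block s a b c -> is_block s a' b' c' -> (a, b, c) = (a', b', c').
Proof.
move=> /is_block_valP[ab bc cn e] /is_block_valP[ab' bc' cn' e'].
have ev i : i < n -> block_val a b c i = block_val a' b' c' i.
  by move=> i_n; rewrite -(e (Ordinal i_n)) -(e' (Ordinal i_n)).
have aE : a = a'.
  apply/eqP; rewrite eqn_leq; apply/andP; split; rewrite leqNgt; apply/negP => lt.
    have := ev a' ltac:(lia); rewrite /block_val; repeat case: ifP; lia.
  have := ev a ltac:(lia); rewrite /block_val; repeat case: ifP; lia.
have bE : b = b'.
  have := ev a ltac:(lia); rewrite /block_val; repeat case: ifP; lia.
subst a' b'; congr (_, _, _).
apply/eqP; rewrite eqn_leq; apply/andP; split; rewrite leqNgt; apply/negP => lt.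
  have := ev (a + (c' - b)) ltac:(lia); rewrite /block_val; repeat case: ifP; lia.
have := ev (a + (c - b)) ltac:(lia); rewrite /block_val; repeat case: ifP; lia.
Qed.

Lemma is_blockP n (s : 'S_n) :
  bigrassmannian s <-> exists a b c, is_block s a b c.
Proof.
split; first exact: bigrassmannian_block.
by move=> [a [b [c]]]; exact: is_block_bigrassmannian.
Qed.

Lemma length_vector_block n (s : 'S_n) a b c : is_block s a b c ->
  length_vector s = (a.+1, b - a, c - b, n.+1 - c).
Proof.
move=> h; rewrite /length_vector; case: pickP => [[[a' b'] c'] /= h'|none].
  by have [-> -> ->] := is_block_uniq h h'.
have [ab bc cn _] := is_block_valP _ _ _ _ h.
have an : a < n.+1 by lia.
have bn : b < n.+1 by lia.
have := none (Ordinal an, Ordinal bn, Ordinal (cn : c < n.+1)).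
by rewrite /= h.
Qed.

Lemma length_vectorP n (s : bigrass n) : exists l1 l2 l3 l4,
  [/\ length_vector (val s) = (l1, l2, l3, l4),
     [&& 0 < l1, 0 < l2, 0 < l3 & 0 < l4] & l1 + l2 + l3 + l4 = n + 2].
Proof.
have /is_blockP[a [b [c h]]] := valP s.
have [ab bc cn _] := is_block_valP _ _ _ _ h.
by exists a.+1, (b - a), (c - b), (n.+1 - c); rewrite (length_vector_block h); split=> //; lia.
Qed.

Lemma length_vector_inj n :
  injective (fun s : bigrass n => length_vector (val s)).
Proof.
move=> s t; have /is_blockP[a [b [c hs]]] := valP s.
have /is_blockP[a' [b' [c' ht]]] := valP t.
rewrite (length_vector_block hs) (length_vector_block ht).
have /is_block_valP[ab bc cn e] := hs; have /is_block_valP[ab' bc' cn' e'] := ht.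
move=> [aE bE cE _]; apply/val_inj/permP => i; apply/val_inj; rewrite /= e e'.
have -> : a' = a by lia.
have -> : b' = b by lia.
by have -> : c' = c by lia.
Qed.

Lemma length_vector_surj n l1 l2 l3 l4 :
  [&& 0 < l1, 0 < l2, 0 < l3 & 0 < l4] -> l1 + l2 + l3 + l4 = n + 2 ->
  exists s : bigrass n, length_vector (val s) = (l1, l2, l3, l4).
Proof.
move=> /and4P[p1 p2 p3 p4] sum.
have [||| s h] := @block_perm n l1.-1 (l1.-1 + l2) (l1.-1 + l2 + l3); try lia.
exists (Sub s (is_block_bigrassmannian h)); rewrite SubK (length_vector_block h).
by congr (_, _, _, _); lia.
Qed.

Lemma length_vector_f2143 n (s : bigrass n) l1 l2 l3 l4 :
  length_vector (val s) = (l1, l2, l3, l4) ->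
  length_vector (val (f2143 s)) = (l2, l1, l4, l3).
Proof.
move=> ls; have [k1 [k2 [k3 [k4 [ks pos sum]]]]] := length_vectorP s.
move: ks; rewrite ls => -[? ? ? ?]; subst k1 k2 k3 k4.
have [||t lt] := @length_vector_surj n l2 l1 l4 l3; try lia.
rewrite /f2143 ls; case: pickP => [u /eqP //|none].
by have := none t; rewrite lt eqxx.
Qed.

(* Main.v *)
(* For bigrassmannian p and s with length vectors (k1, k2, k3, k4) and
   (l1, l2, l3, l4), p <= s holds exactly when l1 <= k1, k2 <= l2, k3 <= l3 and
   l4 <= k4, a condition which is reversed by exchanging l1 with l2 and l3 with
   l4.  For sufficiency, one can move a unit from l2 or l3 to l1 or l4 by a
   chain of adjacent reductions.  For necessity, reductions keep the fixed
   initial and final segments, and they do not increase the number of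
   positions < i with value >= j.  The elements below s then correspond to the
   triples (x, y, z) = (l2 - k2, l3 - k3, k1 - l1) with x < l2, y < l3 and
   z <= x + y. *)
Require Import Defs.
From mathcomp Require Import all_boot all_order all_fingroup all_algebra.
From mathcomp Require Import zify ring.

Set Implicit Arguments.
Unset Strict Implicit.
Unset Printing Implicit Defensive.

(** * Behaviour of inversion, fixed points and ranks under reductions *)

Section Bruhat.
Variable n : nat.
Implicit Types (s t p : 'S_n) (i j k : 'I_n).

Lemma bruhat_refl s : bruhat s s.
Proof. exact: connect0. Qed.

Lemma bruhat_trans t s p : bruhat p t -> bruhat t s -> bruhat p s.
Proof. by move=> pt ts; apply: connect_trans ts pt. Qed.

(** In the inverse the exchanged positions are [s j < s i], and they carry the values [j > i], so
    the exchange is again a reduction. *)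
Lemma reduction_inv s p : reduction s p -> reduction s^-1%g p^-1%g.
Proof.
move=> /existsP[i /existsP[j /and3P[ij sij /eqP ->]]].
apply/existsP; exists (s j); apply/existsP; exists (s i).
rewrite sij !permK ij /=; apply/eqP/permP => k.
rewrite invMg tpermV !permM.
case: (tpermP (s j) (s i) k) => [->|->|k1 k2]; rewrite ?permK ?tpermL ?tpermR //.
by rewrite tpermD //; apply/eqP => e; [apply: k2|apply: k1]; rewrite e permKV.
Qed.

Lemma bruhat_ind (P : 'S_n -> Prop) s p :
  (forall t u, reduction t u -> P t -> P u) -> bruhat p s -> P s -> P p.
Proof.
move=> h /connectP[q]; elim: q s => [|t q IH] s /=; first by move=> _ ->.
by move=> /andP[st tq] e Ps; apply: (IH t tq e); apply: h st Ps.
Qed.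

Lemma bruhat_inv s p : bruhat p s -> bruhat p^-1%g s^-1%g.
Proof.
move=> ps; apply: (bruhat_ind (P := fun u => bruhat u^-1%g s^-1%g) _ ps).
  by move=> t u /reduction_inv tu; apply: bruhat_trans; apply: connect1.
exact: bruhat_refl.
Qed.

(** If a reduction of [t] touched a fixed position [i < m], the smaller entry [t j < i] would also
    be a fixed point; injectivity then gives [t j = j], against [i < j]. *)
Lemma bruhat_fix_lo m s p : bruhat p s ->
  (forall i, i < m -> s i = i) -> forall i, i < m -> p i = i.
Proof.
apply: (bruhat_ind (P := fun u => forall i, i < m -> u i = i)).
move=> t u /existsP[i /existsP[j /and3P[ij tij /eqP ->]]] h k km.
rewrite permM tpermD ?h //; apply/eqP => e; subst k.
  have ti := h _ km; have := h (t j); rewrite ti in tij.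
  by move=> /(_ ltac:(lia))/perm_inj e; move: tij; rewrite e; lia.
have ti := h i ltac:(lia); have := h j km => tj.
by move: tij; rewrite ti tj; lia.
Qed.

Lemma bruhat_fix_hi m s p : bruhat p s ->
  (forall i, m <= i -> s i = i) -> forall i, m <= i -> p i = i.
Proof.
apply: (bruhat_ind (P := fun u => forall i, m <= i -> u i = i)).
move=> t u /existsP[i /existsP[j /and3P[ij tij /eqP ->]]] h k km.
rewrite permM tpermD ?h //; apply/eqP => e; subst k.
  have ti := h i km; have := h j ltac:(lia) => tj.
  by move: tij; rewrite ti tj; lia.
have tj := h _ km; have := h (t i); rewrite tj in tij.
by move=> /(_ ltac:(lia))/perm_inj e; move: tij; rewrite e; lia.
Qed.

Definition perm_rank s (x y : nat) := #|[set k : 'I_n | (k < x) && (y <= s k)]|.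

Lemma bruhat_perm_rank s p x y : bruhat p s -> perm_rank p x y <= perm_rank s x y.
Proof.
move=> ps.
apply: (bruhat_ind (P := fun u => perm_rank u x y <= perm_rank s x y) _ ps) => //.
move=> t u /existsP[i /existsP[j /and3P[ij tij /eqP ->]]]; apply: leq_trans.
(* If both positions lie below [x], the transposition maps the new counted set into the old one.
   Otherwise only position [i] can be counted, and its entry decreases. *)
have [jx|xj] := ltnP j x.
  rewrite /perm_rank -(card_imset _ (@perm_inj _ (tperm i j))).
  apply/subset_leq_card/subsetP => k /imsetP[l]; rewrite !inE permM => h ->.
  case: tpermP h => [->|->|_ _ //]; rewrite ?tpermL ?tpermR; lia.
apply/subset_leq_card/subsetP => k; rewrite !inE permM.
by case: tpermP => [->|->|//]; lia.
Qed.

(** * Sufficiency: moving single units in the length vector *)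

(* h m is the word after m steps, pos m the position of the left entry of the
   adjacent pair exchanged in step m. *)
Lemma bruhat_chain (h : nat -> nat -> nat) (pos : nat -> nat) M s :
  (forall i, s i = h 0 i :> nat) ->
  (forall m, m < M -> [/\ (pos m).+1 < n, h m (pos m).+1 < h m (pos m),
     h m.+1 (pos m) = h m (pos m).+1, h m.+1 (pos m).+1 = h m (pos m) &
     forall x, x <> pos m -> x <> (pos m).+1 -> x < n -> h m.+1 x = h m x]) ->
  exists2 t, bruhat t s & forall i, t i = h M i :> nat.
Proof.
move=> s0; elim: M => [|M IH] step.
  by exists s => //; apply: bruhat_refl.
have [|t ts tM] := IH; first by move=> m mM; apply: step; lia.
have [pn lt e1 e2 e3] := step M (ltnSn M).
have pn' : pos M < n by lia.
exists (tperm (Ordinal pn') (Ordinal pn) * t)%g.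
  apply: bruhat_trans ts; apply/connect1/existsP; exists (Ordinal pn').
  by apply/existsP; exists (Ordinal pn); rewrite !tM /= ltnSn lt eqxx.
move=> i; rewrite permM.
case: tpermP => [->|->|i1 i2]; rewrite tM //= e3 //.
  by move=> e; apply: i1; apply/val_inj.
by move=> e; apply: i2; apply/val_inj.
Qed.

(* The entry a + 1 travels left past the block (b + 1) .. c. *)
Lemma block_lower12 s a b c : is_block s a b c -> a.+1 < b ->
  exists2 t, bruhat t s & is_block t a.+1 b c.
Proof.
move=> /is_block_valP[ab bc cn e] ab'.
pose h m x := if x < a then x else if x < a + (c - b) - m then x + (b - a) else
  if x == a + (c - b) - m then a else if x <= a + (c - b) then x.-1 + (b - a) else
  if x < c then x - (c - b) else x.
have [||t ts te] := @bruhat_chain h (fun m => (a + (c - b) - m).-1) (c - b) s.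
- by move=> i; rewrite e /block_val /h; repeat case: ifP; lia.
- move=> m mM; rewrite /h; split; try (repeat case: ifP; lia).
  by move=> x; repeat case: ifP; lia.
exists t => //; apply/is_block_valP; split; try lia.
by move=> i; rewrite te /block_val /h; repeat case: ifP; lia.
Qed.

(* The entry c travels right past the block (a + 1) .. b. *)
Lemma block_lower43 s a b c : is_block s a b c -> b < c.-1 ->
  exists2 t, bruhat t s & is_block t a b c.-1.
Proof.
move=> /is_block_valP[ab bc cn e] bc'.
pose h m x := if x < a then x else if x.+1 < a + (c - b) then x + (b - a) else
  if x.+1 < a + (c - b) + m then x.+1 - (c - b) else
  if x.+1 == a + (c - b) + m then c.-1 else if x < c then x - (c - b) else x.
have [||t ts te] := @bruhat_chain h (fun m => (a + (c - b) + m).-1) (b - a) s.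
- by move=> i; rewrite e /block_val /h; repeat case: ifP; lia.
- move=> m mM; rewrite /h; split; try (repeat case: ifP; lia).
  by move=> x; repeat case: ifP; lia.
exists t => //; apply/is_block_valP; split; try lia.
by move=> i; rewrite te /block_val /h; repeat case: ifP; lia.
Qed.

(** Inversion exchanges l2 and l3, so this is [block_lower12] for the inverse. The digits name the
    entry that gains a unit and the one that loses it. *)
Lemma block_lower13 s a b c : is_block s a b c -> b < c.-1 ->
  exists2 t, bruhat t s & is_block t a.+1 b.+1 c.
Proof.
move=> sb bc; have [ab _ _ _] := is_block_valP _ _ _ _ sb.
have [|t /bruhat_inv ts /is_block_inv tb] := block_lower12 (is_block_inv sb).
  by lia.
exists t^-1%g; first by rewrite invgK in ts.
by rewrite (_ : b.+1 = a.+1 + (c - (a + (c - b)))) //; lia.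
Qed.

Lemma block_lower42 s a b c : is_block s a b c -> a.+1 < b ->
  exists2 t, bruhat t s & is_block t a b.-1 c.-1.
Proof.
move=> sb ab; have [_ bc _ _] := is_block_valP _ _ _ _ sb.
have [|t /bruhat_inv ts /is_block_inv tb] := block_lower43 (is_block_inv sb).
  by lia.
exists t^-1%g; first by rewrite invgK in ts.
by rewrite (_ : b.-1 = a + (c.-1 - (a + (c - b)))) //; lia.
Qed.

Lemma is_block_inj s t a b c : is_block s a b c -> is_block t a b c -> s = t.
Proof.
move=> /is_block_valP[_ _ _ es] /is_block_valP[_ _ _ et].
by apply/permP => i; apply/val_inj; rewrite /= es et.
Qed.

Lemma block_bruhat_suff s p a b c a' b' c' :
  is_block p a b c -> is_block s a' b' c' ->
  [&& a' <= a, c <= c', b - a <= b' - a' & c - b <= c' - b'] -> bruhat p s.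
Proof.
move=> pb; have [ab bc cn _] := is_block_valP _ _ _ _ pb.
(* The measure is what l1 and l4 of [s] still have to gain. The sum of the four entries is fixed, so
   while it is positive l2 or l3 has a unit to give. *)
have [m] := ubnP ((a - a') + (c' - c)); elim: m => // m IH in s a' b' c' *.
move=> mP sb; have [ab' bc' cn' _] := is_block_valP _ _ _ _ sb => le.
have next a1 b1 c1 : (exists2 t, bruhat t s & is_block t a1 b1 c1) ->
    a - a1 + (c1 - c) < m ->
    [&& a1 <= a, c <= c1, b - a <= b1 - a1 & c - b <= c1 - b1] -> bruhat p s.
  by move=> [t ts tb] lt le1; apply: bruhat_trans ts; apply: IH tb le1.
have [lt|ge] := ltnP a' a.
  have [lt2|ge2] := ltnP (b - a) (b' - a').
    by apply: (next _ _ _ (block_lower12 sb _)); lia.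
  by apply: (next _ _ _ (block_lower13 sb _)); lia.
have [lt'|ge'] := ltnP c c'.
  have [lt2|ge2] := ltnP (b - a) (b' - a').
    by apply: (next _ _ _ (block_lower42 sb _)); lia.
  by apply: (next _ _ _ (block_lower43 sb _)); lia.
have [? ? ?] : [/\ a' = a, b' = b & c' = c] by split; lia.
by subst a' b' c'; rewrite (is_block_inj pb sb); apply: bruhat_refl.
Qed.

(** * Necessity: fixed segments and ranks *)

Lemma card_ord_interval (x y : nat) : #|[set k : 'I_n | x <= k < y]| <= y - x.
Proof.
rewrite cardE -(size_map val) -(size_iota x (y - x)); apply: uniq_leq_size.
  by rewrite map_inj_uniq ?enum_uniq //; apply: val_inj.
by move=> k /mapP[i]; rewrite mem_enum inE mem_iota => h -> /=; lia.
Qed.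

(** [p] moves the positions [a] and [c.-1], so these cannot lie in the segments fixed by [s]. *)
Lemma block_bruhat_fixed s p a b c a' b' c' :
  is_block p a b c -> is_block s a' b' c' -> bruhat p s ->
  (a' <= a) && (c <= c').
Proof.
move=> /is_block_valP[ab bc cn ep] /is_block_valP[ab' bc' cn' es] ps.
apply/andP; split; rewrite leqNgt; apply/negP => lt.
  have an : a < n by lia.
  have /(congr1 val) : p (Ordinal an) = Ordinal an.
    apply: (bruhat_fix_lo (m := a') ps) => // i ia; apply/val_inj.
    by rewrite /= es /block_val ia.
  by rewrite /= ep /block_val /=; repeat case: ifP; lia.
have c1n : c.-1 < n by lia.
have /(congr1 val) : p (Ordinal c1n) = Ordinal c1n.
  apply: (bruhat_fix_hi (m := c') ps) => [i ic|/=]; last by lia.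
  by apply/val_inj; rewrite /= es /block_val; repeat case: ifP; lia.
by rewrite /= ep /block_val /=; repeat case: ifP; lia.
Qed.

Lemma block_bruhat_rank s p a b c a' b' c' :
  is_block p a b c -> is_block s a' b' c' -> bruhat p s ->
  c - b <= c' - b'.
Proof.
move=> pb sb ps; have /andP[aa cc] := block_bruhat_fixed pb sb ps.
move: pb sb => /is_block_valP[ab bc cn ep] /is_block_valP[ab' bc' cn' es].
(* The rank at the descent d of p and the value b is c - b. *)
pose d := a + (c - b); pose e := b + (c' - b').
have le : c - b <= perm_rank p d b.
  have in_n (x : 'I_(c - b)) : a + x < n by have := ltn_ord x; lia.
  rewrite -[X in X <= _]card_ord -cardsT.
  rewrite -(card_imset [set: 'I_(c - b)] (f := fun x => Ordinal (in_n x))).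
    apply/subset_leq_card/subsetP => _ /imsetP[x _ ->].
    rewrite inE ep /block_val /= /d; have := ltn_ord x.
    by repeat case: ifP; lia.
  by move=> x y /(congr1 val) /= h; apply/val_inj => /=; lia.
have := leq_trans le (bruhat_perm_rank d b ps).
(* The block of smaller values in [s] reaches the value [b] only from position [e] on. If [e < d],
   the bound equals [d - b], which would force [b <= a]; hence [d - e] vanishes. *)
have : perm_rank s d b <= (a' + (c' - b') - a') + (d - e).
  have h : [set k : 'I_n | (k < d) && (b <= s k)] \subset
      [set k : 'I_n | a' <= k < a' + (c' - b')] :|: [set k : 'I_n | e <= k < d].
    apply/subsetP => k; rewrite !inE es /block_val /d /e.
    by repeat case: ifP; lia.
  apply: leq_trans (subset_leq_card h) _; apply: leq_trans (leq_card_setU _ _) _.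
  by apply: leq_add; apply: card_ord_interval.
by rewrite /d /e; lia.
Qed.

Lemma block_bruhat s p a b c a' b' c' :
  is_block p a b c -> is_block s a' b' c' ->
  bruhat p s = [&& a' <= a, c <= c', b - a <= b' - a' & c - b <= c' - b'].
Proof.
move=> pb sb; apply/idP/idP; last exact: block_bruhat_suff.
move=> ps; have /andP[-> ->] := block_bruhat_fixed pb sb ps.
rewrite (block_bruhat_rank pb sb ps) andbT /=.
(* For the inverses the rank bound concerns the other middle block and gives [b - a <= b' - a']. *)
have := block_bruhat_rank (is_block_inv pb) (is_block_inv sb) (bruhat_inv ps).
have [ab bc cn _] := is_block_valP _ _ _ _ pb.
have [ab' bc' cn' _] := is_block_valP _ _ _ _ sb.
by lia.
Qed.

End Bruhat.

(** * Length vectors and the duality [f2143] *)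

Lemma bruhat_length_vector n (p s : bigrass n) k1 k2 k3 k4 l1 l2 l3 l4 :
  length_vector (val p) = (k1, k2, k3, k4) ->
  length_vector (val s) = (l1, l2, l3, l4) ->
  bruhat (val p) (val s) = [&& l1 <= k1, k2 <= l2, k3 <= l3 & l4 <= k4].
Proof.
have /is_blockP[a [b [c pb]]] := valP p.
have /is_blockP[a' [b' [c' sb]]] := valP s.
have [ab bc cn _] := is_block_valP _ _ _ _ pb.
have [ab' bc' cn' _] := is_block_valP _ _ _ _ sb.
rewrite (length_vector_block pb) (length_vector_block sb).
by move=> [<- <- <- <-] [<- <- <- <-]; rewrite (block_bruhat pb sb); lia.
Qed.

Lemma bruhat_f2143 n (p s : bigrass n) :
  bruhat (val (f2143 s)) (val (f2143 p)) = bruhat (val p) (val s).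
Proof.
have [k1 [k2 [k3 [k4 [pl _ _]]]]] := length_vectorP p.
have [l1 [l2 [l3 [l4 [sl _ _]]]]] := length_vectorP s.
rewrite (bruhat_length_vector pl sl).
rewrite (bruhat_length_vector (length_vector_f2143 sl) (length_vector_f2143 pl)).
by lia.
Qed.

Lemma f2143K n : involutive (@f2143 n).
Proof.
move=> s; apply: length_vector_inj => /=.
have [l1 [l2 [l3 [l4 [sl _ _]]]]] := length_vectorP s.
by rewrite sl; do 2!apply: length_vector_f2143.
Qed.

(** An order-reversing involution matches the elements above [f2143 s] with those below [s]. *)
Lemma alpha_f2143 n (s : bigrass n) : alpha (f2143 s) = beta s.
Proof.
rewrite /alpha /beta -(card_imset _ (inv_inj (@f2143K n))).
apply: eq_card => p; rewrite inE; apply/imsetP/idP => [[t]|ps].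
  by rewrite inE => st ->; rewrite -bruhat_f2143 f2143K.
by exists (f2143 p); rewrite ?f2143K // inE bruhat_f2143.
Qed.

(** * Counting the elements below [s] *)

Lemma card_beta_triples m1 m2 :
  #|[set t : 'I_m1.+1 * 'I_m2.+1 * 'I_(m1 + m2).+1 | t.2 <= t.1.1 + t.1.2]| * 2
  = m1.+1 * m2.+1 * (m1.+1 + m2.+1).
Proof.
have sumI m : (\sum_(x < m.+1) x) * 2 = m.+1 * m.
  by elim: m => [|m IH]; rewrite big_ord_recr /= ?big_ord0 // mulnDl IH; lia.
have -> : #|[set t : 'I_m1.+1 * 'I_m2.+1 * 'I_(m1 + m2).+1
      | t.2 <= t.1.1 + t.1.2]| = \sum_(x < m1.+1) \sum_(y < m2.+1) (x + y).+1.
  transitivity (\sum_(x < m1.+1) \sum_(y < m2.+1)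
      \sum_(z < (m1 + m2).+1) (z <= x + y : nat)).
    by rewrite pair_bigA pair_bigA -sum1_card big_mkcond;
      apply: eq_bigr => t _; rewrite inE; case: ifP.
  apply: eq_bigr => x _; apply: eq_bigr => y _.
  (* The type of [z] cuts nothing off: all [x + y + 1] values occur. *)
  have lt : (x + y).+1 <= (m1 + m2).+1.
    by have := ltn_ord x; have := ltn_ord y; lia.
  rewrite -[RHS]card_ord -sum1_card (big_ord_widen _ (fun _ => 1) lt).
  by rewrite [RHS]big_mkcond.
under eq_bigr do under eq_bigr do rewrite -addSn.
under eq_bigr do rewrite big_split /= sum_nat_const card_ord.
rewrite big_split /= sum_nat_const card_ord mulnDl -mulnA sumI.
under eq_bigr do rewrite mulnS.
rewrite big_split /= sum_nat_const card_ord -big_distrr /= mulnDl.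
rewrite -(mulnA m2.+1) sumI.
by lia.
Qed.

Lemma beta_length_vector n (s : bigrass n) l1 l2 l3 l4 :
  length_vector (val s) = (l1, l2, l3, l4) ->
  beta s * 2 = l2 * l3 * (l2 + l3).
Proof.
move=> sl; have [k1 [k2 [k3 [k4 [sl' pos sum]]]]] := length_vectorP s.
move: sl'; rewrite sl => -[? ? ? ?]; subst k1 k2 k3 k4.
case: l2 l3 sl pos sum => [|m2] [|m3] sl; try lia; move=> pos sum.
rewrite -card_beta_triples /beta; congr (_ * 2).
pose f (p : bigrass n) : 'I_m2.+1 * 'I_m3.+1 * 'I_(m2 + m3).+1 :=
  let: (k1, k2, k3, _) := length_vector (val p) in
  (inord (m2.+1 - k2), inord (m3.+1 - k3), inord (k1 - l1)).
(* Below [s] the [inord] values are faithful: [l4 <= k4] and the fixed sum give [k1 - l1 <= (l2 -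
   k2) + (l3 - k3) <= m2 + m3]. *)
have fE p k1 k2 k3 k4 : length_vector (val p) = (k1, k2, k3, k4) ->
    bruhat (val p) (val s) ->
    [/\ f p = (inord (m2.+1 - k2), inord (m3.+1 - k3), inord (k1 - l1)),
     [/\ (f p).1.1 = m2.+1 - k2 :> nat, (f p).1.2 = m3.+1 - k3 :> nat
        & (f p).2 = k1 - l1 :> nat],
     [&& 0 < k1, 0 < k2, 0 < k3 & 0 < k4],
     [&& l1 <= k1, k2 <= m2.+1, k3 <= m3.+1 & l4 <= k4] &
     k1 + k2 + k3 + k4 = n + 2].
  move=> pl; rewrite (bruhat_length_vector pl sl) => le.
  have [? [? [? [? [pl' kpos ksum]]]]] := length_vectorP p.
  move: pl'; rewrite pl => -[? ? ? ?]; subst.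
  by split=> //; rewrite /f pl //=; split; rewrite inordK; lia.
rewrite -(card_in_imset (f := f)); last first.
  move=> p q; rewrite !inE => ps qs.
  have [k1 [k2 [k3 [k4 [pl _ _]]]]] := length_vectorP p.
  have [j1 [j2 [j3 [j4 [ql _ _]]]]] := length_vectorP q.
  have [_ [p1 p2 p3] ppos ple psum] := fE _ _ _ _ _ pl ps.
  have [_ [q1 q2 q3] qpos qle qsum] := fE _ _ _ _ _ ql qs.
  move=> e; rewrite e in p1 p2 p3.
  apply: length_vector_inj; rewrite /= pl ql.
  by congr (_, _, _, _); lia.
apply: eq_card => -[[x y] z]; rewrite inE /=; apply/imsetP/idP => [[p]|le].
  rewrite inE => ps e.
  have [k1 [k2 [k3 [k4 [pl _ _]]]]] := length_vectorP p.
  have [_ [p1 p2 p3] ppos ple psum] := fE _ _ _ _ _ pl ps.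
  by rewrite -e /= in p1 p2 p3; lia.
have := ltn_ord x; have := ltn_ord y => yl xl.
(* The fourth entry is dictated by the sum [n + 2]; it is at least [l4] because [z <= x + y]. *)
have [||p pl] := @length_vector_surj n (l1 + z) (m2.+1 - x) (m3.+1 - y)
  (l4 + (x + y - z)); try lia.
have ps : bruhat (val p) (val s) by rewrite (bruhat_length_vector pl sl); lia.
exists p; rewrite ?inE //.
have [-> _ _ _ _] := fE _ _ _ _ _ pl ps.
by congr (_, _, _); apply/val_inj; rewrite /= inordK; lia.
Qed.

Lemma half_natr (m k : nat) : m * 2 = k -> (m%:R = 1 / 2 * k%:R :> rat)%R.
Proof. by move=> <-; rewrite GRing.natrM; field. Qed.

Theorem corollary2p3 (n : nat) (n_ge1 : 1 <= n) (p s : bigrass n)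
    (l1 l2 l3 l4 : nat)
    (ls : length_vector (val s) = (l1, l2, l3, l4)) :
  [/\ bruhat (val p) (val s) <-> bruhat (val (f2143 s)) (val (f2143 p)),
      ((beta s)%:R = 1 / 2 * (l2%:R * l3%:R * (l2%:R + l3%:R)) :> rat)%R,
      ((alpha s)%:R = 1 / 2 * (l1%:R * l4%:R * (l1%:R + l4%:R)) :> rat)%R
    & beta s = alpha (f2143 s)].
Proof.
split; last by rewrite alpha_f2143.
- by rewrite bruhat_f2143.
- by rewrite (half_natr (beta_length_vector ls)) !GRing.natrM GRing.natrD.
(* [alpha s] becomes [beta (f2143 s)], and the middle entries of [f2143 s] are [l1] and [l4]. *)
rewrite -[s]f2143K alpha_f2143.
rewrite (half_natr (beta_length_vector (length_vector_f2143 ls))).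
by rewrite !GRing.natrM GRing.natrD.
Qed.
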